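(* Let $G$ be a finite $2$-group, and let $A$ be a finite $2$-group acting on $G$ by automorphisms. (i) If $G/G^{4}$ (with the induced action of $A$) is $d$-maximal for $A$-subgroups, then so is $G$. (ii) If $G/G^{4}$ is minimal non-metacyclic, then so is $G$.
   Context: All groups are finite. For a finite $p$-group $G$, $d(G)$ denotes the minimal number of generators of $G$. If a group $A$ acts on $G$ (by automorphisms), an $A$-subgroup of $G$ is a subgroup of $G$ which is $A$-invariant. The group $G$ is called $d$-maximal for $A$-subgroups if $d(H)<d(G)$ for every proper $A$-subgroup $H$ of $G$. $G^{4}$ denotes the subgroup $\langle x^{4}\mid x\in G\rangle$. A group $X$ is called minimal non-metacyclic if $X$ is not metacyclic but all its proper subgroups are metacyclic. *)

(* Defs.v *)
From mathcomp Require Import all_boot all_fingroup all_solvable.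

Set Implicit Arguments.
Unset Strict Implicit.
Unset Printing Implicit Defensive.

Local Open Scope group_scope.

Section PowerSubgroup.

Variables (gT : finGroupType) (n : nat).

Definition power_subgroup (G : {group gT}) : {group gT} :=
  <<[set x ^+ n | x in G]>>%G.

Lemma power_subgroup_sub (G : {group gT}) : power_subgroup G \subset G.
Proof.
by rewrite gen_subG; apply/subsetP=> _ /imsetP[x Gx ->]; rewrite groupX.
Qed.

End PowerSubgroup.

Section DMaximal.

Variables (aT rT : finGroupType) (D : {group aT}) (R : {group rT}).
Variable to : groupAction D R.

Definition d_maximal (A : {group aT}) (G : {group rT}) : Prop :=
  forall H : {group rT}, H \proper G -> [acts A, on H | to] -> 'm(H) < 'm(G).

(* The library's quotient action to / N has domain qact_dom to N, which can   *)
(* be smaller than D in general.  For a power subgroup N of R it is all of D, *)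
(* so no A-subgroup of R / N is lost in d_maximal.                            *)
Lemma qact_dom_power n : qact_dom to (power_subgroup n R) = D.
Proof.
rewrite qact_domE ?power_subgroup_sub //.
apply/eqP; rewrite eqEsubset subsetIl /=.
have sPR : [set x ^+ n | x in R] \subset R.
  by apply/subsetP=> _ /imsetP[x Rx ->]; rewrite groupX.
apply: acts_gen => //.
apply/subsetP=> a Da; rewrite !inE Da; apply/subsetP=> _ /imsetP[x Rx ->].
rewrite inE gactX //; apply: imset_f.
by rewrite gact_stable.
Qed.

End DMaximal.

Definition minimal_nonmetacyclic (gT : finGroupType) (G : {group gT}) : Prop :=
  ~~ metacyclic G /\
  forall H : {group gT}, H \proper G -> metacyclic H.

(* Main.v *)
(** For a finite 2-group [H], [#|H : 'Phi(H)|] is [2 ^ d(H)].  Put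
    [P = 'Phi(G)]; then [G^4 <= 'Phi(P)], because a fourth power is the square
    of a square.  So for [P <= L <= G] the subgroup [G^4] lies in ['Phi(L)] and
    [d(L)] can be computed in [G / G^4].

    (i) Let [S] be the semidirect product of [G] by [A].  By the above, every
    [L <| S] with [P <= L < G] satisfies [d(L) < d(G)].  If [[P, G]] were not
    in ['Phi(P)], the centralizer [C] in [G] of [P] modulo a suitable [S]-normal
    subgroup would have [d(C) >= d(G)].  Hence [[P, G] <= 'Phi(P)], which makes
    [P] behave like a powerful group: [d(K) <= d(P)] for all [K <= P], and this
    in turn gives [d(H) <= d(HP)] for all [H <= G].  For [H] proper and
    [A]-invariant, [HP] is a proper normal subgroup of [S], so [d(HP) < d(G)].

    (ii) A 2-group is metacyclic as soon as it and its maximal subgroups are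
    2-generated (Blackburn).  Applied to [G / G^4] this forces [d(G) >= 3], so
    ['Phi(M) = P] for every maximal subgroup [M]; the maximal subgroups of [M]
    then contain [P], are therefore 2-generated, and [M] is metacyclic. *)

Require Import Defs.
From mathcomp Require Import all_boot all_fingroup all_solvable.

Set Implicit Arguments.
Unset Strict Implicit.
Unset Printing Implicit Defensive.

Local Open Scope group_scope.

(** * Frattini subgroups of 2-groups and their indices *)

Section Frattini2groups.

Variable gT : finGroupType.
Implicit Types (A B G H K M N P T X Y Z : {group gT}) (x g : gT).

Lemma sqr_Phi G x : 2.-group G -> x \in G -> x ^+ 2 \in 'Phi(G).
Proof.
move=> pG Gx; rewrite (Phi_joing pG).
apply: (subsetP (joing_subr _ _)); apply: (Mho_p_elt 1 Gx).
exact: mem_p_elt pG Gx.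
Qed.

(** It is enough to test squares because every commutator is a product of squares and their
    inverses. *)
Lemma sub_Phi_sqr G K :
  2.-group G -> {in G, forall x, x ^+ 2 \in K} -> 'Phi(G) \subset K.
Proof.
move=> pG G2K; rewrite (Phi_joing pG) join_subG; apply/andP; split.
  rewrite gen_subG; apply/subsetP=> _ /imset2P[x y Gx Gy ->].
  have ->: [~ x, y] = (x ^+ 2)^-1 * ((x * y^-1) ^+ 2 * y ^+ 2).
    rewrite commgEl conjgE !expgS !expg0 !mulg1 !invMg !mulgA.
    by rewrite !mulgKV.
  by rewrite groupM ?groupV ?G2K // groupM ?G2K // groupM ?groupV.
rewrite (MhoE 1 pG) gen_subG; apply/subsetP=> _ /imsetP[x Gx ->].
exact: G2K.
Qed.

Lemma der_sub_Phi G : 2.-group G -> [~: G, G] \subset 'Phi(G).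
Proof. by move=> pG; rewrite (Phi_joing pG) joing_subl. Qed.

Lemma commXg_conj x g : [~ x ^+ 2, g] = [~ x, g] ^ x * [~ x, g].
Proof. by rewrite expgS expg1 commMgJ. Qed.

(** Burnside's basis theorem: representatives of a minimal generating set of [G / 'Phi(G)] generate
    [G] together with ['Phi(G)], hence on their own. *)
Lemma grank_2group G : 2.-group G -> 'm(G) = logn 2 #|G : 'Phi(G)|.
Proof.
move=> pG; have nPG := normal_norm (Phi_normal G).
have abQ := Phi_quotient_abelem pG.
have mQ : 'm(G / 'Phi(G)) = logn 2 #|G : 'Phi(G)|.
  rewrite grank_abelian ?(abelem_abelian abQ) // -card_quotient //.
  by rewrite (rank_abelem abQ).
apply/eqP; rewrite eqn_leq -mQ quotient_grank // andbT mQ.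
rewrite -mQ; have [B defB <-] := grank_witness (G / 'Phi(G))%G.
(* [set_of_coset] exposes a coset as a subset of [gT], from which [repr] picks an element. *)
pose C := (repr : {set _} -> gT) @: (@set_of_coset _ 'Phi(G) @: B).
have sBG : B \subset G / 'Phi(G) by rewrite -defB subset_gen.
have reprK b : b \in B -> repr b \in G /\ coset 'Phi(G) (repr b) = b.
  move=> Bb; rewrite coset_reprK; split=> //.
  move: (coset_reprK b) (repr_coset_norm b); move: (repr b) => r cr Nr.
  rewrite -(quotientGK (Phi_normal G)) mem_morphpre //=.
  by rewrite cr (subsetP sBG).
have sCG : C \subset G.
  apply/subsetP=> _ /imsetP[_ /imsetP[b Bb ->] ->].
  by case: (reprK b Bb).
have: <<C>> = G.
  apply: Phi_nongen; apply/eqP; rewrite eqEsubset join_subG Phi_sub sCG /=.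
  rewrite -(quotientSGK nPG) ?joing_subl //= -defB gen_subG.
  apply/subsetP=> b Bb; case: (reprK b Bb) => Gb <-.
  apply: mem_quotient; apply: (subsetP (joing_subr _ _)).
  by apply/imsetP; exists (b : {set _}) => //; apply: imset_f.
move=> defC; rewrite -{1}defC (leq_trans (grank_min _)) //.
by rewrite (leq_trans (leq_imset_card _ _)) // leq_imset_card.
Qed.

Lemma index_Phi_quotient G N :
  2.-group G -> G \subset 'N(N) -> N \subset 'Phi(G) ->
  #|G / N : 'Phi(G / N)| = #|G : 'Phi(G)|.
Proof.
move=> pG nNG sNP; rewrite -(quotient_Phi pG nNG).
by rewrite index_quotient_eq ?Phi_sub // (subset_trans (subsetIr _ _)).
Qed.

Lemma index_Phi_quotient_leq G N :
  2.-group G -> G \subset 'N(N) ->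
  #|G / N : 'Phi(G / N)| <= #|G : 'Phi(G)|.
Proof.
move=> pG nNG; rewrite -(quotient_Phi pG nNG) dvdn_leq //.
by rewrite index_quotient // subIset ?nNG.
Qed.

(* That is, [#|H : 'Phi(H)| <= #|H * B : 'Phi(H) * 'Phi(B)|], stated     *)
(* with cardinals because the products need not be groups.                    *)
Lemma index_Phi_join H B :
    2.-group H -> 2.-group B ->
    #|H :&: B : 'Phi(H :&: B)| <= #|B : 'Phi(B)| ->
  (#|H| * #|('Phi(H) * 'Phi(B))%g| <= #|(H * B)%g| * #|'Phi(H)|)%N.
Proof.
move=> pH pB; set K := (H :&: B)%G => leKB.
have sPK : 'Phi(K) \subset 'Phi(H) :&: 'Phi(B).
  by rewrite subsetI (PhiS pH) ?(PhiS pB) ?subsetIl ?subsetIr.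
have eHB := mul_cardG H B; have ePP := mul_cardG 'Phi(H) 'Phi(B).
have K_gt0 : 0 < #|H :&: B| by apply: (cardG_gt0 K).
have P_gt0 : 0 < #|'Phi(H) :&: 'Phi(B)| by apply: (cardG_gt0 (_ :&: _)%G).
(* The product formula, applied to both products, reduces the claim to this inequality between
   intersections. *)
have leKP : (#|H :&: B| * #|'Phi(B)| <= #|B| * #|'Phi(H) :&: 'Phi(B)|)%N.
  rewrite -(Lagrange (Phi_sub B)) -(Lagrange (Phi_sub K)) mulnC -!mulnA.
  by rewrite leq_mul // mulnC leq_mul // subset_leq_card.
have KP_gt0 : (0 < #|H :&: B| * #|'Phi(H) :&: 'Phi(B)|)%N.
  by rewrite muln_gt0 K_gt0.
rewrite -(leq_pmul2r KP_gt0).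
rewrite mulnACA -ePP [leqRHS]mulnACA -eHB mulnACA [leqRHS]mulnACA.
by rewrite leq_mul.
Qed.

(** Induction along a chain of maximal subgroups from [Y] up to [X]: passing from [M] to [X],
    generated by [M] and [x], doubles the right side, and intersecting with ['C_G[x]] at most
    doubles the left. *)
Lemma index_cent_leq G X Y :
    2.-group X -> Y \subset X -> Y \subset 'C(G) ->
    {in X, forall x, #|G : 'C_G[x]| <= 2} ->
  #|G : 'C_G(X)| <= #|X : Y|.
Proof.
have [n] := ubnP #|X|; elim: n X => // n IHn X ltXn pX sYX cYG idx2.
have [defX | [M maxM sYM]] := maximal_exists sYX.
  by rewrite -[gval X]defX (setIidPl _) 1?centsC // !indexgg.
have [sMX [x Xx notMx]] := properP (maxgroupp maxM).
have oXM := p_maximal_index pX maxM.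
have defX : M <*> <[x]> = X.
  apply/eqP; rewrite eqEsubset join_subG sMX cycle_subG Xx /=.
  apply: contraLR isT => ns; case/maxgroupP: maxM => _ /(_ (M <*> <[x]>)%G).
  rewrite properE ns /= join_subG sMX cycle_subG Xx joing_subl => /(_ isT isT).
  move=> eMx; case/negP: notMx; rewrite -eMx /=.
  by apply: (subsetP (joing_subr _ _)); apply: cycle_id.
have leM : #|G : 'C_G(M)| <= #|M : Y|.
  apply: IHn => //; first exact: leq_trans (proper_card (maxgroupp maxM)) _.
    exact: pgroupS pX.
  by move=> y My; apply: idx2; apply: (subsetP sMX).
have -> : 'C_G(X) = 'C_G(M) :&: 'C_G[x].
  by rewrite -setIIr -cent_cycle -centY defX.
have:= Lagrange_index (subsetIl G 'C(M)) (subsetIl 'C_G(M) 'C_G[x]) => /= <-.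
rewrite -(Lagrange_index sMX sYM) oXM mulnC leq_mul //.
rewrite indexgI (leq_trans _ (idx2 x Xx)) // subset_leq_card //.
exact: imsetS (subsetIl _ _).
Qed.

(* Commutation pairs [P / 'C_P(G)] with [G / 'C_G(P)], which bounds the index *)
(* of ['C_G(P)], while squares of elements of ['C_G(P)] are central in [G].   *)
Lemma index_Phi_cent G Z (P := 'Phi(G)%G) :
    2.-group G -> 2.-abelem P -> [~: P, G] \subset Z -> #|Z| <= 2 ->
  #|G : P| <= #|'C_G(P) : 'Phi('C_G(P))|.
Proof.
move=> pG abP sRZ leZ2; have pP : 2.-group P := abelem_pgroup abP.
have sPG : P \subset G := Phi_sub G.
have [cPP P2] := abelemP (isT : prime 2) abP.
set C := 'C_G(P)%G; set Z0 := 'C_P(G)%G.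
have sZ0C : Z0 \subset C by rewrite setISS // centS.
(* The [G]-class of [x] in [P] lies in the coset of [Z] through [x], so it has at most two
   elements. *)
have leGC : #|G : C| <= #|P : Z0|.
  apply: index_cent_leq => //; rewrite ?subsetIl ?subsetIr // => x Px.
  rewrite index_cent1 (leq_trans _ leZ2) // -(card_lcoset Z x).
  apply: subset_leq_card.
  apply/subsetP=> _ /imsetP[g Gg ->]; rewrite mem_lcoset -commgEl.
  by rewrite (subsetP sRZ) // mem_commg.
have sPhiC : 'Phi(C) \subset Z0.
  apply: sub_Phi_sqr; first exact: pgroupS (subsetIl _ _) pG.
  move=> x /setIP[Gx /centP cPx]; rewrite inE sqr_Phi //.
  apply/centP=> g Gg; apply/commgP; rewrite commXg_conj.
  have Pxg : [~ x, g] \in P.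
    by rewrite (subsetP (der_sub_Phi pG)) // mem_commg.
  by rewrite conjgE -(cPx _ Pxg) mulKg; apply/eqP/P2.
have Z0_gt0 := cardG_gt0 Z0.
apply: (@leq_trans #|C : Z0|); last by rewrite dvdn_leq // indexgS.
rewrite -(leq_pmul2l Z0_gt0) (Lagrange sZ0C).
rewrite -(leq_pmul2r (_ : 0 < #|P : Z0|)) // mulnAC.
rewrite Lagrange ?subsetIl // Lagrange //.
by rewrite -(Lagrange (subsetIl G 'C(P))) leq_mul.
Qed.

(** Since [[~: G, A]] is centralized by [G] and its elements square to 1, [[~ x ^+ 2, a] = [~ x, a]
    ^+ 2 = 1]. *)
Lemma sqr_cent_Phi G A B :
    2.-group G -> 2.-abelem B -> [~: G, A] \subset B -> [~: [~: G, A], G] = 1 ->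
  'Phi(G) \subset 'C(A).
Proof.
move=> pG abB sRB /commG1P cRG; apply: sub_Phi_sqr => // x Gx.
apply/centP=> a Aa; apply/commgP; rewrite commXg_conj.
have Rxa: [~ x, a] \in [~: G, A] by rewrite mem_commg.
rewrite conjgE (centP (subsetP cRG _ Rxa) _ Gx) mulKg.
have [_ B2] := abelemP (isT : prime 2) abB.
by apply/eqP/B2; apply: (subsetP sRB).
Qed.

(** By [sqr_cent_Phi], ['Phi(G)] and hence [T] centralizes [B]. So [t] commutes with [[~ t, g]], and
    [[~ t ^+ 2, g] = [~ t, g] ^+ 2 = 1]; the squares [t ^+ 2] generate [B]. *)
Lemma Phi_cent_of_commG1 G T (B := 'Phi(T)%G) :
    2.-group G -> 2.-abelem B -> T <| G -> T \subset 'Phi(G) ->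
    [~: T, G] \subset B -> [~: B, G, G] = 1 ->
  [~: B, G] = 1.
Proof.
move=> pG abB /andP[sTG nTG] sTP sRB RGG.
have pT := pgroupS sTG pG.
have nBG : G \subset 'N(B) := gFnorm_trans _ nTG.
have cBP : 'Phi(G) \subset 'C(B).
  by apply: (sqr_cent_Phi pG abB); rewrite ![[~: G, _]]commGC ?commg_subl.
apply/commG1P; apply: sub_Phi_sqr => // t Tt.
apply/centP=> g Gg; apply/commgP; rewrite commXg_conj.
have Rtg: [~ t, g] \in B by rewrite (subsetP sRB) ?mem_commg.
rewrite conjgE -(centP (subsetP cBP _ (subsetP sTP _ Tt)) _ Rtg) mulKg.
have [_ B2] := abelemP (isT : prime 2) abB.
by apply/eqP/B2.
Qed.

(** In an abelian 2-group, [#|X : 'Phi(X)|] is the order of ['Ohm_1(X)], which is monotone in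
    [X]. *)
Lemma card_Phi_abelian X Y :
    2.-group X -> abelian X -> Y \subset X ->
  (#|'Phi(X)| * #|Y| <= #|X| * #|'Phi(Y)|)%N.
Proof.
move=> pX cXX sYX; have cYY := abelianS sYX cXX; have pY := pgroupS sYX pX.
rewrite (Phi_Mho pX cXX) (Phi_Mho pY cYY).
rewrite -(mul_card_Ohm_Mho_abelian 1 cXX) -(mul_card_Ohm_Mho_abelian 1 cYY).
by rewrite mulnA leq_mul // mulnC leq_mul // subset_leq_card // OhmS.
Qed.

End Frattini2groups.

(** * Commutators of [G] with Frattini subgroups *)

Section PhiQuotients.

Variable gT : finGroupType.
Implicit Types (G K L M P R S T W X : {group gT}).

(** If the conclusion fails, choose [R] normal in [S], containing ['Phi(P)] and of index 2 in [W].
    By [index_Phi_cent] in [G / R], the preimage [L] of the centralizer of [P / R] violates the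
    bound on proper [S]-normal subgroups. *)
Lemma Phi_cent_mod_Phi S G (P := 'Phi(G)%G) :
    2.-group S -> G <| S ->
    (forall L, L <| S -> P \subset L -> L \proper G ->
       #|L : 'Phi(L)| < #|G : P|) ->
  [~: P, G] \subset 'Phi(P).
Proof.
move=> pS nsGS ltL; have [sGS nGS] := andP nsGS.
have pG := pgroupS sGS pS; have sPG : P \subset G := Phi_sub G.
have nsPS : P <| S := gFnormal_trans _ nsGS.
have nsPPS : 'Phi(P) <| S := gFnormal_trans _ nsPS.
have pP := pgroupS sPG pG.
apply: contraLR isT => nsRP.
pose W := ([~: P, G] <*> 'Phi(P))%G.
have sRP : [~: P, G] \subset P by rewrite commg_subl gFnorm.
have sWP : W \subset P by rewrite join_subG sRP Phi_sub.
have nsWS : W <| S.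
  rewrite /normal (subset_trans (subset_trans sWP sPG)) //=.
  by rewrite normsY ?normsR ?(normal_norm nsPS) ?(normal_norm nsPPS).
have nsPW : 'Phi(P) <| W.
  by rewrite /normal joing_subr (subset_trans sWP) ?gFnorm.
pose Q := (W / 'Phi(P))%G.
have nsQ : Q <| S / 'Phi(P) by apply: quotient_normal.
have pW := pgroupS sWP pP.
have ntQ : Q :!=: 1.
  rewrite -subG1 quotient_sub1 ?normal_norm //.
  by apply: contra nsRP; apply: subset_trans; apply: joing_subl.
(* [Q] has order [2 ^ m.+1]; being normal in a 2-group, it contains a normal subgroup of that group
   of order [2 ^ m]. *)
have [_ _ [m oQ]] := pgroup_pdiv (quotient_pgroup _ pW : 2.-group Q) ntQ.
have := normal_pgroup (r := m) (quotient_pgroup _ pS) nsQ.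
rewrite oQ pfactorK // => /(_ (leqnSn m)) [R0 [sR0Q nsR0 oR0]].
have [R defR0 sPR nsRS] := inv_quotientN nsPPS nsR0.
have nRS := normal_norm nsRS.
have sRW : R \subset W.
  have nPR := subset_trans (normal_sub nsRS) (normal_norm nsPPS).
  by rewrite -(quotientSGK _ (normal_sub nsPW)) -?defR0.
have iWR : #|W : R| = 2.
  have := Lagrange sR0Q; rewrite oR0 oQ defR0.
  rewrite index_quotient_eq ?subIset ?sPR ?(normal_norm nsPW) ?orbT //.
  by rewrite expnSr => /eqP; rewrite eqn_pmul2l ?expn_gt0 // => /eqP.
have sWG := subset_trans sWP sPG.
have nRG := subset_trans sGS nRS; have nRW := subset_trans sWG nRG.
have nRP := subset_trans sPG nRG.
have sRP' : R \subset P := subset_trans sRW sWP.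
have ePQ : 'Phi(G / R) = P / R by rewrite -(quotient_Phi pG).
have leGC : #|G / R : P / R| <= #|'C_(G / R)(P / R) : 'Phi('C_(G / R)(P / R))|.
  have := @index_Phi_cent _ (G / R)%G (W / R)%G; rewrite /= ePQ; apply.
  - exact: quotient_pgroup.
  - by rewrite -trivg_Phi ?quotient_pgroup // -(quotient_Phi pP) // quotientS1.
  - by rewrite -quotientR // quotientS ?joing_subl.
  by rewrite card_quotient // iWR.
have nsGQ : (G / R) <| S / R by apply: quotient_normal.
have nsCQ : 'C_(G / R)(P / R) <| S / R.
  rewrite /normal subIset ?(normal_sub nsGQ) //= normsI ?(normal_norm nsGQ) //.
  by rewrite norms_cent // quotient_norms // normal_norm.
have [L defL sRL nsLS] := inv_quotientN nsRS nsCQ.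
have sLG : L \subset G.
  have nRL := subset_trans (normal_sub nsLS) nRS.
  by rewrite -(quotientSGK nRL (subset_trans sRP' sPG)) -defL subsetIl.
have cPP : [~: P, P] \subset R := subset_trans (der_sub_Phi pP) sPR.
have sPL : P \subset L.
  rewrite -(quotientSGK nRP sRL) -defL subsetI quotientS //=.
  by rewrite quotient_cents2r.
have ltLG : L \proper G.
  (* If [L] were [G], then [G / R] would centralize [P / R], so [[~: P, G]], and with it [W], would
     lie in [R]. *)
  rewrite properE sLG; apply/negP=> sGL.
  suffices: #|W : R| = 1%N by rewrite iWR.
  apply/eqP; rewrite indexg_eq1 join_subG sPR andbT.
  rewrite -quotient_cents2 // centsC; apply: subset_trans (quotientS R sGL) _.
  by rewrite -defL subsetIr.
have:= ltL L nsLS sPL ltLG; rewrite ltnNge => /negP[].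
rewrite -(index_quotient_eq _ sPG nRG) ?subIset ?sRP' ?orbT //.
apply: leq_trans leGC _; rewrite defL.
by apply: index_Phi_quotient_leq; [apply: pgroupS pG | apply: subset_trans nRG].
Qed.

(** Modulo [K = [~: B, G, G]] the previous case applies and gives [[~: B, G] \subset K]; in a
    nilpotent group this forces [[~: B, G]] to be trivial. *)
Lemma Phi_cent_of_abelem G T (B := 'Phi(T)%G) :
    2.-group G -> 2.-abelem B -> T <| G -> T \subset 'Phi(G) ->
    [~: T, G] \subset B ->
  [~: B, G] = 1.
Proof.
move=> pG abB nsTG sTP sRB; have [sTG nTG] := andP nsTG.
have pT := pgroupS sTG pG; have sBT : B \subset T := Phi_sub T.
have sBG := subset_trans sBT sTG.
have nBG : G \subset 'N(B) := gFnorm_trans _ nTG.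
have sRB' : [~: B, G] \subset B by rewrite commg_subl.
have nRG : G \subset 'N([~: B, G]) by rewrite normsR ?normG.
pose K := [~: B, G, G]%G.
have nKG : G \subset 'N(K) by rewrite normsR ?normG.
have sKR : K \subset [~: B, G] by rewrite commg_subl.
have sKB := subset_trans sKR sRB'.
have ePT : 'Phi(T / K) = B / K.
  by rewrite -(quotient_Phi pT) // (subset_trans sTG).
have R1 : [~: B / K, G / K] = 1.
  rewrite -ePT; apply: Phi_cent_of_commG1.
  - exact: quotient_pgroup.
  - by rewrite /= ePT quotient_abelem.
  - exact: quotient_normal.
  - by rewrite -(quotient_Phi pG nKG) quotientS.
  - by rewrite /= ePT -quotientR ?quotientS // (subset_trans sTG).
  rewrite /= ePT -!quotientR ?(subset_trans sBG) //; last first.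
    by rewrite (subset_trans sRB') ?(subset_trans sBG).
  exact: trivg_quotient.
have sRK : [~: B, G] \subset K.
  rewrite -quotient_sub1 ?(subset_trans sRB') ?(subset_trans sBG) //.
  by rewrite quotientR ?R1 ?(subset_trans sBG).
have /forall_inP/(_ [~: B, G]%G) := pgroup_nil pG.
rewrite subsetI sRK (subset_trans sRB' sBG) => /(_ isT) /eqP //.
Qed.

End PhiQuotients.

(** * Generator numbers of subgroups *)

Section PhiRank.

Variable gT : finGroupType.
Implicit Types (A G H K L P S T X : {group gT}) (x g : gT).

(** The inductive step for [index_Phi_sub]: the hypotheses descend from [T] to [B], and the last
    conclusion makes [T / 'Phi(B)] abelian, as [T] lies in ['Phi(G)]. Both commutator claims are
    checked modulo ['Phi(B)], where [B] is elementary abelian. *)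
Lemma Phi_step G T (B := 'Phi(T)%G) :
    2.-group G -> T <| G -> T \subset 'Phi(G) -> [~: T, G] \subset B ->
  [/\ B <| G, B \subset 'Phi(G), [~: B, G] \subset 'Phi(B)
    & [~: T, 'Phi(G)] \subset 'Phi(B)].
Proof.
move=> pG nsTG sTP sRB; have [sTG nTG] := andP nsTG.
have sBT : B \subset T := Phi_sub T.
have nsBG : B <| G := gFnormal_trans _ nsTG; have [sBG nBG] := andP nsBG.
have nFG : G \subset 'N('Phi(B)) := gFnorm_trans _ nBG.
have pT := pgroupS sTG pG; have pB := pgroupS sBG pG.
have ePT : 'Phi(T / 'Phi(B)) = B / 'Phi(B).
  by rewrite -(quotient_Phi pT) // (subset_trans sTG).
have ePG : 'Phi(G / 'Phi(B)) = 'Phi(G) / 'Phi(B) by rewrite -(quotient_Phi pG).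
have abB := Phi_quotient_abelem pB.
have nFT := subset_trans sTG nFG; have nFB := subset_trans sBG nFG.
have sRQ : [~: T / 'Phi(B), G / 'Phi(B)] \subset B / 'Phi(B).
  by rewrite -quotientR ?quotientS.
have R1 : [~: B / 'Phi(B), G / 'Phi(B)] = 1.
  have := @Phi_cent_of_abelem _ (G / 'Phi(B))%G (T / 'Phi(B))%G.
  rewrite /= ePT ePG.
  by apply; rewrite ?quotient_pgroup ?quotient_normal ?quotientS.
have sPG := Phi_sub G; have nFP := subset_trans sPG nFG.
split=> //; first exact: subset_trans sBT sTP.
  by rewrite -quotient_cents2 //; apply/commG1P.
rewrite commGC -quotient_cents2 // -ePG.
apply: (sqr_cent_Phi (quotient_pgroup _ pG) abB).
  by rewrite commGC.
rewrite (commGC _ (T / _)).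
by apply/trivgP; rewrite -R1 commSg.
Qed.

(** Induction on [T], descending to [B = 'Phi(T)]. The inductive bound for [K :&: B] feeds
    [index_Phi_join], which compares [K] with [K * B]; the abelian group [T / 'Phi(B)] then compares
    [K * B] with [T]. *)
Lemma index_Phi_sub G T K :
    2.-group G -> T <| G -> T \subset 'Phi(G) -> [~: T, G] \subset 'Phi(T) ->
    K \subset T ->
  #|K : 'Phi(K)| <= #|T : 'Phi(T)|.
Proof.
move=> pG; have [n] := ubnP #|T|.
elim: n T K => // n IHn T K ltTn nsTG sTP sRB sKT.
have [T1 | ntT] := eqsVneq T 1.
  rewrite (_ : K = T) //; apply/val_inj/eqP.
  by rewrite eqEsubset sKT /= T1 sub1G.
have [sTG nTG] := andP nsTG.
have pT := pgroupS sTG pG; have pK := pgroupS sKT pT.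
have [nsBG sBP sRF sTF] := Phi_step pG nsTG sTP sRB.
set B := 'Phi(T)%G in nsBG sBP sRF sTF.
have pB := pgroupS (normal_sub nsBG) pG.
have sBT : B \subset T := Phi_sub T.
have leKB : #|K :&: B : 'Phi(K :&: B)| <= #|B : 'Phi(B)|.
  apply: IHn => //; last exact: subsetIr.
  exact: leq_trans (proper_card (Phi_proper ntT)) _.
have nFT : T \subset 'N('Phi(B)) by rewrite !gFnorm_trans // normG.
have nFK := subset_trans sKT nFT.
have cTT : abelian (T / 'Phi(B)).
  by rewrite /abelian quotient_cents2 // (subset_trans (commgS _ sTP)).
have cKB : B / 'Phi(B) \subset 'C(K / 'Phi(B)).
  by apply: sub_abelian_cent2 cTT _ _; apply: quotientS.
have sKBT : K <*> B \subset T by rewrite join_subG sKT sBT.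
have eKB : K <*> B = K * B by rewrite norm_joinEl // (subset_trans sKT) ?gFnorm.
have nFPK := subset_trans (Phi_sub K) nFK.
have ePP : 'Phi(K) <*> 'Phi(B) = 'Phi(K) * 'Phi(B) by rewrite norm_joinEl.
(* This is [card_Phi_abelian] for the image of [K * B] in [T / 'Phi(B)], with each order multiplied
   back by that of ['Phi(B)]. *)
have sqrT : (#|B| * #|(K * B)%g| <= #|T| * #|('Phi(K) * 'Phi(B))%g|)%N.
  have := card_Phi_abelian (quotient_pgroup 'Phi(B) pT) cTT (quotientS _ sKBT).
  have -> : 'Phi((K <*> B) / 'Phi(B)) = ('Phi(K) <*> 'Phi(B)) / 'Phi(B).
    rewrite eKB quotientMl // (Phi_mulg (p := 2)) ?quotient_pgroup //.
    rewrite Phi_quotient_id mulg1 quotientYidr //.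
    by rewrite (quotient_Phi pK).
  rewrite -(quotient_Phi pT) //.
  have cardF X : 'Phi(B) \subset X -> X \subset T ->
      #|X| = (#|X / 'Phi(B)| * #|'Phi(B)|)%N.
    move=> sFX sXT; rewrite card_quotient ?(subset_trans sXT) //.
    by rewrite mulnC Lagrange.
  have sFB : 'Phi(B) \subset B := Phi_sub B.
  rewrite -eKB -ePP (cardF B) // (cardF T) ?(subset_trans sFB) //.
  rewrite (cardF (K <*> B)%G) ?(subset_trans sFB) ?joing_subr //.
  rewrite (cardF ('Phi(K) <*> 'Phi(B))%G) ?joing_subr //; last first.
    by rewrite join_subG (subset_trans sFB) // (subset_trans (Phi_sub K)).
  by move=> leX; rewrite mulnACA [leqRHS]mulnACA leq_mul2r leX orbT.
have := index_Phi_join pK pB leKB.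
rewrite -(Lagrange (Phi_sub K)) -mulnA [leqRHS]mulnC leq_pmul2l ?cardG_gt0 //.
rewrite -(Lagrange sBT) -mulnA leq_pmul2l ?cardG_gt0 // in sqrT => leK.
rewrite -(leq_pmul2r (_ : 0 < #|('Phi(K) * 'Phi(B))%g|)).
  exact: leq_trans leK sqrT.
by rewrite -ePP cardG_gt0.
Qed.

(** Squares [(h * p) ^+ 2] lie in ['Phi(H) * 'Phi(P)], because [[~ p, h]] is in ['Phi(P)]. Then
    [index_Phi_join] applies, its hypothesis on [H :&: P] coming from [index_Phi_sub]. *)
Lemma index_Phi_leq_join G H (P := 'Phi(G)%G) :
    2.-group G -> [~: P, G] \subset 'Phi(P) -> H \subset G ->
  #|H : 'Phi(H)| <= #|H <*> P : 'Phi(H <*> P)|.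
Proof.
move=> pG sRF sHG; have pH := pgroupS sHG pG.
have sPG : P \subset G := Phi_sub G; have pP := pgroupS sPG pG.
have nPG : G \subset 'N(P) := gFnorm _ _; have nPH := subset_trans sHG nPG.
have sHPG : H <*> P \subset G by rewrite join_subG sHG.
have nFH : 'Phi(H) \subset 'N('Phi(P)).
  by rewrite gFnorm_trans // (subset_trans (Phi_sub H)).
have sPhi : 'Phi(H <*> P) \subset 'Phi(H) <*> 'Phi(P).
  apply: sub_Phi_sqr; first exact: pgroupS pG.
  move=> x /=; rewrite norm_joinEl // => /mulsgP[h p Hh Pp ->].
  have -> : (h * p) ^+ 2 = h ^+ 2 * (p ^+ 2 * [~ p, h] ^ p).
    by rewrite commgEl !conjgE !expgS !expg0 !mulg1 !mulgA !mulgK.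
  have sFF := subsetP (joing_subr 'Phi(H) 'Phi(P)).
  rewrite groupM //; first by rewrite (subsetP (joing_subl _ _)) ?sqr_Phi.
  apply: sFF; rewrite groupM ?sqr_Phi //.
  rewrite memJ_norm ?(subsetP (gFnorm _ P)) // (subsetP sRF) // mem_commg //.
  exact: (subsetP sHG).
have leHP : #|H :&: P : 'Phi(H :&: P)| <= #|P : 'Phi(P)|.
  by apply: (index_Phi_sub (G := G)) (subsetIr H P) => //; apply: Phi_normal.
have := index_Phi_join pH pP leHP.
rewrite -!norm_joinEl // -(Lagrange (Phi_sub H)) -mulnA [leqRHS]mulnC.
rewrite leq_pmul2l ?cardG_gt0 // -(Lagrange (Phi_sub (H <*> P)%G)) /= => le1.
rewrite -(leq_pmul2r (cardG_gt0 'Phi(H <*> P))) [leqRHS]mulnC.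
by apply: leq_trans le1; rewrite leq_mul2l subset_leq_card ?orbT.
Qed.

(** [H <*> P] is normalized by [G], as it contains the derived subgroup, and by [A]; it is proper
    because [P] consists of non-generators. *)
Lemma index_Phi_ltn S G A H (P := 'Phi(G)%G) :
    2.-group S -> G <| S -> S \subset G * A ->
    (forall L, L <| S -> P \subset L -> L \proper G ->
       #|L : 'Phi(L)| < #|G : P|) ->
    A \subset S -> A \subset 'N(H) -> H \proper G ->
  #|H : 'Phi(H)| < #|G : P|.
Proof.
move=> pS nsGS sSGA ltL sAS nHA ltHG; have [sGS nGS] := andP nsGS.
have pG := pgroupS sGS pS; have sHG := proper_sub ltHG.
have sPG : P \subset G := Phi_sub G.
have sHPG : H <*> P \subset G by rewrite join_subG sHG.
have sRF := Phi_cent_mod_Phi pS nsGS ltL.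
apply: leq_ltn_trans (index_Phi_leq_join pG sRF sHG) _.
apply: (ltL (H <*> P)%G); rewrite ?joing_subr //.
  rewrite /normal (subset_trans sHPG) //= (subset_trans sSGA) // mul_subG //.
    rewrite /normaliser sub_der1_norm // (subset_trans (der_sub_Phi pG)) //.
    exact: joing_subr.
  rewrite normsY // (subset_trans sAS) //.
  exact: gFnorm_trans.
rewrite properEneq sHPG andbT; apply: contraL ltHG => /eqP defG.
have := @Phi_nongen _ G H; rewrite joingC genGid defG => -> //.
by rewrite properxx.
Qed.

Lemma index_Phi_grank G : 2.-group G -> #|G : 'Phi(G)| = (2 ^ 'm(G))%N.
Proof.
move=> pG; rewrite grank_2group // -p_part part_pnat_id //.
exact: pnat_dvd (dvdn_indexg _ _) pG.
Qed.

Lemma power4_sub_Phi2 G :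
  2.-group G -> power_subgroup 4 G \subset 'Phi('Phi(G)).
Proof.
move=> pG; rewrite gen_subG; apply/subsetP=> _ /imsetP[x Gx ->].
rewrite (expgM x 2 2) sqr_Phi //; last exact: sqr_Phi.
exact: pgroupS (Phi_sub G) pG.
Qed.

Lemma power_subgroup_norm n G : G \subset 'N(power_subgroup n G).
Proof.
apply: norms_gen; apply/subsetP=> g Gg; rewrite inE.
apply/subsetP=> _ /imsetP[_ /imsetP[x Gx ->] ->]; rewrite conjXg.
by apply/imsetP; exists (x ^ g); rewrite ?groupJ.
Qed.

Lemma index_Phi_mod_power4 G L :
    2.-group G -> 'Phi(G) \subset L -> L \subset G ->
  #|L / power_subgroup 4 G : 'Phi(L / power_subgroup 4 G)| = #|L : 'Phi(L)|.
Proof.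
move=> pG sPL sLG; have pL := pgroupS sLG pG.
have sNL : power_subgroup 4 G \subset 'Phi(L).
  exact: subset_trans (power4_sub_Phi2 pG) (PhiS pL sPL).
apply: index_Phi_quotient => //.
exact: subset_trans sLG (power_subgroup_norm 4 G).
Qed.

End PhiRank.

(** * Part (i): lifting d-maximality *)

Lemma d_maximal_of_quotient (aT rT : finGroupType) (A : {group aT})
    (G : {group rT}) (to : groupAction A G) :
    2.-group A -> 2.-group G ->
  d_maximal (to / power_subgroup 4 G)%gact A (G / power_subgroup 4 G)%G ->
  d_maximal to A G.
Proof.
move=> pA pG dmaxQ H ltHG actsH.
have sHG := proper_sub ltHG; have pH := pgroupS sHG pG.
rewrite -(ltn_exp2l _ _ (ltnSn 1)) -!index_Phi_grank //.
(* [G] and [A] are replaced by their copies [G1] and [A1] in the semidirect product, where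
   invariance under the action becomes normalization by [A1]. *)
have injf := injm_sdpair1 to.
have [nsG1 _ defS nGA _] := sdprod_context (sdprod_sdpair to).
pose S := [set: sdprod_by to]%G.
pose G1 := (sdpair1 to @* G)%G; pose A1 := (sdpair2 to @* A)%G.
have pS : 2.-group S.
  by rewrite /= -defS pgroupM !morphim_pgroup.
have indf (K : {group rT}) : K \subset G ->
    #|sdpair1 to @* K : 'Phi(sdpair1 to @* K)| = #|K : 'Phi(K)|.
  by move=> sKG; rewrite -injm_Phi // index_injm.
rewrite -indf // -[#|G : _|]indf //.
apply: (@index_Phi_ltn _ S G1 A1); rewrite ?subsetT //=.
- by rewrite defS.
- move=> L nsLS sPL /properP[sLG [y Gy notLy]].
  have [M sMG defL] : exists2 M : {group rT}, M \subset G & sdpair1 to @* M = L.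
    exists (sdpair1 to @*^-1 L)%G; first exact: subsetIl.
    by apply: morphpreK.
  have sPM : 'Phi(G) \subset M.
    by rewrite -(injmSK injf) ?Phi_sub //= defL injm_Phi.
  rewrite -defL !indf //.
  rewrite -(index_Phi_mod_power4 pG sPM sMG).
  rewrite -[X in _ < X](index_Phi_mod_power4 pG (Phi_sub G) (subxx G)).
  rewrite !index_Phi_grank ?quotient_pgroup ?(pgroupS sMG) // ltn_exp2l //.
  (* [M / power_subgroup 4 G] is an [A]-subgroup: [qact_dom_power] puts all of [A] in the domain of
     the quotient action, and [A1] normalizes [L]. *)
  apply: dmaxQ; last first.
    rewrite acts_quotient // subsetI qact_dom_power subxx.
    rewrite actsEsd // defL.
    exact: subset_trans (subsetT _) (normal_norm nsLS).
  rewrite properE quotientS //=; apply/negP.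
  rewrite quotientSGK ?power_subgroup_norm //; last first.
    apply: subset_trans (power4_sub_Phi2 pG) _.
    exact: subset_trans (Phi_sub _) sPM.
  move=> sGM; case/negP: notLy; rewrite -defL.
  by apply: (subsetP (morphimS _ sGM)).
- by rewrite -actsEsd.
by rewrite properE !injmSK // -properE.
Qed.

(** * Metacyclic and 2-generated groups *)

Section Metacyclic.

Variable gT : finGroupType.
Implicit Types (G : {group gT}) (x y : gT).

Lemma metacyclic_normal_cycle G x y :
  <[x]> <| G -> <[x]> <*> <[y]> = G -> metacyclic G.
Proof.
move=> nsxG defG; apply/metacyclicP; exists <[x]>%G.
split; rewrite ?cycle_cyclic //.
have sYG : <[y]> \subset G by rewrite -defG joing_subr.
rewrite -defG quotientYidl ?quotient_cyclic ?cycle_cyclic //.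
exact: subset_trans sYG (normal_norm nsxG).
Qed.

Lemma metacyclic_der1_cycle G x y :
  <[x]> <*> <[y]> = G -> [~: G, G] \subset <[x]> -> metacyclic G.
Proof.
move=> defG sRx; apply: metacyclic_normal_cycle (defG).
by apply: sub_der1_normal; rewrite // -defG joing_subl.
Qed.

Lemma metacyclic_cycles G :
  metacyclic G -> exists x y, <[x]> <| G /\ <[x]> <*> <[y]> = G.
Proof.
case/metacyclicP=> _ [/cyclicP[x ->] nsxG /cyclicP[Y defQ]].
have: Y \in G / <[x]> by rewrite defQ cycle_id.
case/morphimP=> y Ny Gy defY; exists x, y; split=> //.
rewrite norm_joinEr ?cycle_subG // -quotientK ?cycle_subG //.
by rewrite quotient_cycle // -defY -defQ quotientGK.
Qed.

Lemma metacyclic_grank G : metacyclic G -> 'm(G) <= 2.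
Proof.
case/metacyclic_cycles=> x [y [_ <-]].
have -> : <[x]> <*> <[y]> = <<[set x; y]>>.
  by rewrite /cycle joing_idl joing_idr.
by rewrite (leq_trans (grank_min _)) // cards2; case: eqP.
Qed.

Lemma grank2_joing_cycle G : 'm(G) <= 2 -> exists x y, <[x]> <*> <[y]> = G.
Proof.
have joinE x y : <[x]> <*> <[y]> = <<[set x; y]>>.
  by rewrite /cycle joing_idl joing_idr.
have [B <- <-] := grank_witness G; rewrite leq_eqVlt ltnS leq_eqVlt ltnS leqn0.
case/or3P=> [/cards2P[x [y [_ ->]]] | /cards1P[x ->] | /eqP/cards0_eq->].
- by exists x, y.
- by exists x, x; rewrite joinE setUid.
by exists 1, 1; rewrite joinE setUid -[<<_>>]/(<[1]>) cycle1 gen0.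
Qed.

Lemma abelian_metacyclic G : abelian G -> 'm(G) <= 2 -> metacyclic G.
Proof.
move=> cGG /grank2_joing_cycle[x [y defG]].
by apply: (metacyclic_der1_cycle defG); rewrite (commG1P cGG) sub1G.
Qed.

Lemma abelian_dprod2 G :
  abelian G -> 'm(G) <= 2 -> exists x y, <[x]> \x <[y]> = G.
Proof.
move=> cGG; rewrite grank_abelian // -size_abelian_type //.
have [b defG <-] := abelian_structure cGG; rewrite size_map.
case: b defG => [|x [|y []]] // defG _.
- by exists 1, 1; rewrite -defG big_nil cycle1 dprod1g.
- by exists x, 1; rewrite -defG big_seq1 cycle1 dprodg1.
by exists x, y; rewrite -defG big_cons big_seq1.
Qed.


End Metacyclic.

(** * Blackburn's criterion for metacyclic 2-groups *)

Section Blackburn.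

Variable gT : finGroupType.
Implicit Types (G H K M N U : {group gT}) (a b g : gT).

Lemma commX_cent a g n : commute a (a ^ g) -> [~ a ^+ n, g] = [~ a, g] ^+ n.
Proof.
move=> caag; rewrite !commgEl conjXg [RHS]expgMn ?expgVn //.
exact: commute_sym (commuteV (commute_sym caag)).
Qed.

(** As [N] lies in ['Phi(G)], lifts [u] and [g] of the generators of [G / N] generate [G]. The
    preimage [U = N * <[u]>] is abelian and normal, and contains [c = [~ u, g]], whose powers
    exhaust the derived subgroup. *)
Lemma der1_cyclic_or_metacyclic G N :
    2.-group G -> N \subset [~: G, G] -> N \subset 'Z(G) -> #|N| = 2 ->
    metacyclic (G / N) ->
  metacyclic G \/ [~: G, G] = N.
Proof.
move=> pG sNR sNZ oN; have [sNG cNG] := subsetIP sNZ.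
have nsNG : N <| G by apply: sub_center_normal.
have nNG := normal_norm nsNG.
have sNPhi : N \subset 'Phi(G) := subset_trans sNR (der_sub_Phi pG).
case/metacyclic_cycles=> ub [gb [nsub defQ]].
have /morphimP[u Nu Gu defu] : ub \in G / N.
  by rewrite -defQ (subsetP (joing_subl _ _)) ?cycle_id.
have /morphimP[g Ng Gg defg] : gb \in G / N.
  by rewrite -defQ (subsetP (joing_subr _ _)) ?cycle_id.
have defG : <[u]> <*> <[g]> = G.
  have := @Phi_nongen _ G (<[u]> <*> <[g]>); rewrite genGid; apply.
  apply/eqP; rewrite eqEsubset join_subG Phi_sub join_subG !cycle_subG Gu Gg /=.
  rewrite -(quotientSGK nNG) ?(subset_trans sNPhi) ?joing_subl //.
  rewrite -defQ defu defg -!quotient_cycle // -quotientY ?cycle_subG //.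
  by rewrite quotientS ?joing_subr.
have [U defUb sNU nsUG] := inv_quotientN nsNG nsub.
have defU : U = N * <[u]> :> {set gT}.
  rewrite -quotientK ?cycle_subG // quotient_cycle // -defu defUb.
  by rewrite quotientGK // (normalS sNU (normal_sub nsUG)).
have cNu : <[u]> \subset 'C(N).
  by rewrite centsC (subset_trans cNG) // centS // cycle_subG.
have cUU : abelian U.
  rewrite defU -cent_joinEr // abelianY cycle_abelian cNu /= !andbT.
  by rewrite /abelian (subset_trans cNG) ?centS.
have Uu : u \in U by rewrite defU (subsetP (mulG_subr _ _)) // cycle_id.
(* [G^`(1) = <[c]>]; if [c ^+ 2 != 1], then [N <= <[c ^+ 2]> <= <[u]>]. *)
set c := [~ u, g].
have Uug : u ^ g \in U by rewrite memJ_norm // (subsetP (normal_norm nsUG)).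
have Uc : c \in U by rewrite /c commgEl groupM ?groupV.
have nN1 n : n \in N -> n ^+ 2 = 1.
  by move=> Nn; apply/eqP; rewrite -order_dvdn -oN order_dvdG.
(* [u] centralizes [c] inside [U]. Writing [u ^ g = n * u ^+ i] with [n] central gives [c ^ g =
   [~ u ^+ i, g] = c ^+ i]. *)
have ncG : G \subset 'N(<[c]>).
  rewrite -defG join_subG !cycle_subG; apply/andP; split.
    rewrite -cycle_subG cents_norm // cent_cycle cycle_subG.
    exact/cent1P/(centsP cUU).
  rewrite inE -cycleJ cycle_subG.
  have: u ^ g \in N * <[u]> by rewrite -defU.
  case/mulsgP=> n _ Nn /cycleP[i ->] defug.
  have -> : c ^ g = [~ u ^ g, g] by rewrite /c !commgEl conjMg conjVg.
  have cn : [~ n, g] = 1 by apply/eqP/commgP/(centP (subsetP cNG _ Nn)).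
  rewrite defug commMgJ cn conj1g mul1g commX_cent ?mem_cycle //.
  exact: (centsP cUU).
have sRc : [~: G, G] \subset <[c]>.
  have nc x : x \in G -> x \in 'N(<[c]>) by apply: subsetP ncG x.
  rewrite -quotient_cents2 // -defG quotientY ?cycle_subG ?nc //.
  rewrite !quotient_cycle ?nc // -/(abelian _) abelianY !cycle_abelian /=.
  apply/centsP=> _ /cycleP[i ->] _ /cycleP[j ->]; apply/commuteX2/commute_sym.
  by apply/commgP; rewrite -morphR ?nc //= coset_id ?cycle_id.
have sNc := subset_trans sNR sRc.
have [c2 | nc2] := eqVneq (c ^+ 2) 1.
  right; apply/eqP; rewrite eq_sym eqEcard sNR oN.
  apply: leq_trans (subset_leq_card sRc) _.
  by rewrite -[#|_|]/#[c] dvdn_leq // order_dvdn c2.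
left; apply: (metacyclic_der1_cycle defG); apply: subset_trans sRc _.
have Gc := subsetP (normal_sub nsUG) _ Uc.
suffices sNu : N \subset <[u]> by rewrite cycle_subG -(mulSGid sNu) -defU.
have /cyclicP[z defz] : cyclic N by rewrite prime_cyclic ?oN.
have: z \in <[c]> by rewrite (subsetP sNc) // defz cycle_id.
case/cycleP=> i defi; have oz : #[z] = 2 by rewrite /order -defz.
(* For odd [i], [z] would generate [<[c]>], forcing [c ^+ 2 = 1]. For even [i], [z] is a power of
   [c ^+ 2], hence of [u], since the [N]-part of [c] squares to 1. *)
have [odd_i | even_i] := boolP (odd i).
  case/eqP: nc2; apply/eqP; rewrite -order_dvdn -oz defi.
  have: generator <[c]> (c ^+ i).
    rewrite generator_coprime; apply: (@pnat_coprime 2).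
      exact: mem_p_elt pG Gc.
    by rewrite -odd_2'nat.
  by rewrite /generator /order => /eqP <-.
have: c \in N * <[u]> by rewrite -defU.
case/mulsgP=> n _ Nn /cycleP[j ->] defc.
have defc2 : c ^+ 2 = (u ^+ j) ^+ 2.
  rewrite defc expgMn; first by rewrite (nN1 n) // mul1g.
  by apply: (centP (subsetP cNG _ Nn)); rewrite groupX.
rewrite defz cycle_subG defi -(odd_double_half i) (negPf even_i) add0n -mul2n.
by rewrite expgM defc2 !groupX ?cycle_id.
Qed.

(** The witness is [M], generated by the central element [a ^+ 2], by [b] and by the derived
    subgroup. It has order at least [#[a] * #[b]], while ['Phi(M) = <[a ^+ 4]> * <[b ^+ 2]>] has
    order at most an eighth of that. *)
Lemma index_Phi_gt4 G a b :
    2.-group G -> #|[~: G, G]| = 2 -> <[a]> <*> <[b]> = G ->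
    #|G| = (2 * (#[a] * #[b]))%N -> a ^+ 2 != 1 -> b != 1 ->
  exists2 H : {group gT}, H \subset G & #|G : H| <= 2 /\ 4 < #|H : 'Phi(H)|.
Proof.
move=> pG oR defG oG nta2 ntb.
pose N := [~: G, G]%G; have nsNG : N <| G := der_normal 1 G.
have [sNG nNG] := andP nsNG.
have cNG : G \subset 'C(N).
  have := meet_center_nil (pgroup_nil pG) nsNG.
  rewrite trivg_card1 oR => /(_ isT) ntNZ; rewrite centsC.
  have /setIidPl <- : N \subset 'Z(G).
    by apply: contraR ntNZ => /(prime_TIg _)->//; rewrite [#|_|]oR.
  exact: subset_trans (subsetIr _ _) (subsetIr _ _).
have N2 n : n \in N -> n ^+ 2 = 1.
  by move=> Nn; apply/eqP; rewrite -order_dvdn -oR order_dvdG.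
have Ga : a \in G by rewrite -cycle_subG -defG joing_subl.
have Gb : b \in G by rewrite -cycle_subG -defG joing_subr.
have Za2 : a ^+ 2 \in 'C(G).
  apply/centP=> y Gy; apply/commgP; rewrite commXg_conj.
  have Ny : [~ a, y] \in N by apply: mem_commg.
  by rewrite conjgE -(centP (subsetP cNG _ Ga) _ Ny) mulKg; apply/eqP/(N2 _ Ny).
pose K := (<[a ^+ 2]> <*> <[b]>)%G; pose M := (K <*> N)%G.
have cab : <[b]> \subset 'C(<[a ^+ 2]>).
  by rewrite centsC cycle_subG (subsetP (centS _) _ Za2) // cycle_subG.
have sKG : K \subset G by rewrite join_subG !cycle_subG groupX.
have cKN : N \subset 'C(K) by rewrite centsC (subset_trans sKG).
have sMG : M \subset G by rewrite join_subG sKG.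
have pK := pgroupS sKG pG; have pN := pgroupS sNG pG.
have nsMG : M <| G by apply: sub_der1_normal => //; apply: joing_subr.
exists M => //.
have iGM : #|G : M| <= 2.
  have nMG := normal_norm nsMG; rewrite -card_quotient //.
  have -> : G / M = <[coset M a]>.
    rewrite -quotient_cycle ?(subsetP nMG) //.
    have Mb : <[b]> \subset M.
      by rewrite (subset_trans _ (joing_subl _ _)) ?joing_subr.
    rewrite -{1}defG quotientY ?cycle_subG ?(subsetP nMG) //.
    by rewrite (quotientS1 Mb) joingG1.
  rewrite -[#|_|]/#[_] dvdn_leq // order_dvdn -morphX ?(subsetP nMG) //=.
  rewrite coset_id //.
  apply: (subsetP (joing_subl _ _)); apply: (subsetP (joing_subl _ _)).
  exact: cycle_id.
split=> //; rewrite ltnNge; apply/negP=> leM4.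
have pa := mem_p_elt pG Ga; have pb := mem_p_elt pG Gb.
have ePK : 'Phi(K) = <[a ^+ 4]> * <[b ^+ 2]>.
  have pa2 : 2.-group <[a ^+ 2]> by rewrite (pgroupS _ pG) // cycle_subG groupX.
  rewrite /K /= cent_joinEr // (Phi_mulg (p := 2)) //.
  rewrite !(@Phi_Mho _ 2) ?cycle_abelian //.
  by rewrite !(@Mho_p_cycle _ _ 2) // -expgM.
have ePM : 'Phi(M) = <[a ^+ 4]> * <[b ^+ 2]>.
  rewrite -ePK /M /= cent_joinEr // (Phi_mulg (p := 2)) //.
  rewrite [X in _ * X](_ : _ = 1) ?mulg1 //; apply/trivgP.
  by apply: sub_Phi_sqr => // n Nn; rewrite N2.
have lePM : #|'Phi(M)| <= #[a ^+ 4] * #[b ^+ 2].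
  by rewrite /order ePM mul_cardG leq_pmulr // cardG_gt0.
(* [1 < k] and [0 < l] ensure that [a ^+ 4] and [b ^+ 2] have orders exactly [2 ^ (k - 2)] and
   [2 ^ (l - 1)]. *)
have [k oa] := p_natP pa; have [l ob] := p_natP pb.
have k_gt1 : 1 < k.
  rewrite ltnNge; apply: contra nta2 => lek1; rewrite -order_dvdn oa.
  by rewrite (dvdn_exp2l 2 lek1).
have l_gt0 : 0 < l.
  by rewrite lt0n; apply: contra ntb => /eqP l0; rewrite -order_eq1 ob l0.
have leM : #[a] * #[b] <= #|M|.
  rewrite -(leq_pmul2l (ltn0Sn 1)) -oG -(Lagrange sMG) mulnC.
  by rewrite leq_mul2r iGM orbT.
move: leM; apply/negP; rewrite -ltnNge -(Lagrange (Phi_sub M)).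
apply: leq_ltn_trans (leq_mul lePM leM4) _.
rewrite (orderXexp 2 oa) (orderXexp 1 ob) oa ob -!expnD -(expnD 2 _ 2).
by rewrite ltn_exp2l // addnAC subnK // ltn_add2l subn1 prednK.
Qed.

(** The hypothesis of Blackburn's criterion: for a 2-group, index at most 2 covers [G] and its
    maximal subgroups at once, and the bound 4 expresses 2-generation. *)
Definition rank2_up_to_index2 G :=
  forall H, H \subset G -> #|G : H| <= 2 -> #|H : 'Phi(H)| <= 4.

Lemma rank2_up_to_index2_grank G :
  2.-group G -> rank2_up_to_index2 G -> 'm(G) <= 2.
Proof.
move=> pG /(_ G (subxx G)); rewrite indexgg index_Phi_grank // => /(_ isT).
by rewrite (leq_exp2l _ 2).
Qed.

(** If [G] is not metacyclic, no member of a generating pair has the derived subgroup [N] among its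
    powers. Hence lifts [a], [b] of a basis of [G / N] keep their orders, and [index_Phi_gt4] forces
    both to square to 1. *)
Lemma metacyclic_small_der1 G :
    2.-group G -> rank2_up_to_index2 G -> #|[~: G, G]| = 2 ->
  metacyclic G.
Proof.
move=> pG rank2G oR; apply: contraT => nmG.
pose N := [~: G, G]%G; have nsNG : N <| G := der_normal 1 G.
have [sNG nNG] := andP nsNG.
have nTI w v : <[w]> <*> <[v]> = G -> N :&: <[w]> = 1.
  move=> defG; apply: prime_TIg; first by rewrite [#|_|]oR.
  by apply: contra nmG => /(metacyclic_der1_cycle defG).
have mQ : 'm(G / N) <= 2.
  exact: leq_trans (quotient_grank nNG) (rank2_up_to_index2_grank pG rank2G).
have [ab [bb defQ]] := abelian_dprod2 (der_abelian 0 G : abelian (G / N)) mQ.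
have [_ defQ' _ _] := dprodP defQ.
have /morphimP[a Na Ga defa] : ab \in G / N.
  by rewrite -defQ' (subsetP (mulG_subl _ _)) ?cycle_id.
have /morphimP[b Nb Gb defb] : bb \in G / N.
  by rewrite -defQ' (subsetP (mulG_subr _ _)) ?cycle_id.
have defG : <[a]> <*> <[b]> = G.
  have := @Phi_nongen _ G (<[a]> <*> <[b]>); rewrite genGid; apply.
  apply/eqP; rewrite eqEsubset join_subG Phi_sub join_subG !cycle_subG Ga Gb /=.
  rewrite -(quotientSGK nNG) ?(subset_trans (der_sub_Phi pG)) ?joing_subl //.
  rewrite -defQ' defa defb -!quotient_cycle // -quotientMl ?cycle_subG //.
  rewrite quotientS // (subset_trans _ (joing_subr _ _)) //.
  by rewrite mul_subG ?joing_subl ?joing_subr.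
have defG' : <[b]> <*> <[a]> = G by rewrite joingC.
have oq w v : <[w]> <*> <[v]> = G -> #[coset N w] = #[w].
  move=> dG; have Gw : w \in G by rewrite -cycle_subG -dG joing_subl.
  have nw : <[w]> \subset 'N(N) by rewrite cycle_subG (subsetP nNG).
  rewrite /order -quotient_cycle -?cycle_subG //.
  by rewrite -(card_isog (quotient_isog nw (nTI _ _ dG))).
have oG : #|G| = (2 * (#[a] * #[b]))%N.
  rewrite -(Lagrange sNG) [#|N|]oR -card_quotient // -(dprod_card defQ).
  by rewrite -(oq _ _ defG) -(oq _ _ defG') -defa -defb.
have nab : [~ a, b] != 1.
  apply: contra nmG => /commgP cab; apply: abelian_metacyclic.
    rewrite -defG abelianY !cycle_abelian /=.
    apply/centsP=> _ /cycleP[i ->] _ /cycleP[j ->].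
    exact/commuteX2/commute_sym.
  exact: rank2_up_to_index2_grank.
have nta : a != 1 by apply: contraNneq nab => ->; rewrite comm1g.
have ntb : b != 1 by apply: contraNneq nab => ->; rewrite commg1.
have [a2 | nta2] := eqVneq (a ^+ 2) 1; last first.
  have [H sHG [iGH]] := index_Phi_gt4 pG oR defG oG nta2 ntb.
  by rewrite ltnNge rank2G.
have [b2 | ntb2] := eqVneq (b ^+ 2) 1; last first.
  rewrite [X in (2 * X)%N]mulnC in oG.
  have [H sHG [iGH]] := index_Phi_gt4 pG oR defG' oG ntb2 nta.
  by rewrite ltnNge rank2G.
(* The pair [a * b], [b] also generates [G], so [N] meets [<[a * b]>] trivially; yet this commutator
   lies in both. *)
have defab : [~ a, b] = (a * b) ^+ 2.
  have aV : a^-1 = a by apply/eqP; rewrite eq_invg_mul; apply/eqP.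
  have bV : b^-1 = b by apply/eqP; rewrite eq_invg_mul; apply/eqP.
  by rewrite commgEl conjgE aV bV expgS expg1 !mulgA.
case/eqP: nab; apply/set1gP; rewrite -(nTI (a * b) b).
  apply/setIP; split; first exact: mem_commg.
  by rewrite defab groupX ?cycle_id.
apply/eqP; rewrite eqEsubset join_subG !cycle_subG groupM // Gb /=.
rewrite -{1}defG join_subG !cycle_subG andbC.
have Jb : b \in <[a * b]> <*> <[b]>.
  by rewrite (subsetP (joing_subr _ _)) ?cycle_id.
rewrite Jb -[a in a \in _](mulgK b) groupM ?groupV //.
by rewrite (subsetP (joing_subl _ _)) ?cycle_id.
Qed.

End Blackburn.

Lemma quotient_metacyclic (gT : finGroupType) (G N : {group gT}) :
  G \subset 'N(N) -> metacyclic G -> metacyclic (G / N).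
Proof.
move=> nNG /metacyclic_cycles[x [y [nsxG defG]]].
have [sXG sYG] : <[x]> \subset G /\ <[y]> \subset G.
  by rewrite -defG joing_subl joing_subr.
have [nNx nNy] := (subset_trans sXG nNG, subset_trans sYG nNG).
apply: (@metacyclic_normal_cycle _ _ (coset N x) (coset N y)).
  by rewrite -quotient_cycle -?cycle_subG // quotient_normal.
by rewrite -!quotient_cycle -?cycle_subG // -quotientY // defG.
Qed.

(** Induction through [G / N], with [N] central of order 2 inside the derived subgroup. The
    hypothesis passes to quotients, and the exceptional case where [N] is the whole derived subgroup
    is [metacyclic_small_der1]. *)
Lemma metacyclic_rank2_up_to_index2 (gT : finGroupType) (G : {group gT}) :
  2.-group G -> rank2_up_to_index2 G -> metacyclic G.
Proof.
have [n] := ubnP #|G|; elim: n gT G => // n IHn gT G ltGn pG rank2G.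
have mG := rank2_up_to_index2_grank pG rank2G.
have [R1 | ntR] := eqsVneq [~: G, G] 1.
  by apply: abelian_metacyclic => //; apply/commG1P.
have nsRG : [~: G, G]%G <| G := der_normal 1 G.
pose C := ([~: G, G] :&: 'Z(G))%G.
have ntC : C :!=: 1 := meet_center_nil (pgroup_nil pG) nsRG ntR.
have sCG : C \subset G by rewrite subIset // (normal_sub nsRG).
have [_ dv2 _] := pgroup_pdiv (pgroupS sCG pG) ntC.
have [z Cz oz] := Cauchy (isT : prime 2) dv2.
have [Rz Zz] := setIP Cz; pose N := <[z]>%G.
have sNZ : N \subset 'Z(G) by rewrite cycle_subG.
have sNR : N \subset [~: G, G] by rewrite cycle_subG.
have nsNG : N <| G := sub_center_normal sNZ; have [sNG nNG] := andP nsNG.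
have [|//|eRN] := der1_cyclic_or_metacyclic pG sNR sNZ oz; last first.
  by apply: metacyclic_small_der1 => //; rewrite eRN.
apply: IHn; rewrite ?quotient_pgroup //.
  apply: leq_trans (ltn_quotient _ sNG) _ => //.
  by rewrite -cardG_gt1 [#|_|]oz.
move=> Hb sHbG iGH; have [H defH sNH sHG] := inv_quotientS nsNG sHbG.
rewrite defH in iGH *.
have nNH := subset_trans sHG nNG.
apply: leq_trans (index_Phi_quotient_leq (pgroupS sHG pG) nNH) _.
apply: rank2G => //; rewrite -(index_quotient_eq _ sHG nNG) //.
by rewrite subIset // sNH orbT.
Qed.

(** * Part (ii): lifting minimal non-metacyclicity *)

Lemma minimal_nonmetacyclic_of_quotient (rT : finGroupType) (G : {group rT}) :
    2.-group G -> minimal_nonmetacyclic (G / power_subgroup 4 G)%G ->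
  minimal_nonmetacyclic G.
Proof.
set N := power_subgroup 4 G => pG [nmQ metaQ].
have nNG : G \subset 'N(N) := power_subgroup_norm 4 G.
split; first by apply: contra nmQ => mG; apply: quotient_metacyclic.
pose P := 'Phi(G)%G; have sPG : P \subset G := Phi_sub G.
have sNFP : N \subset 'Phi(P) := power4_sub_Phi2 pG.
have sNP : N \subset P := subset_trans sNFP (Phi_sub P).
have pQ : 2.-group (G / N) := quotient_pgroup N pG.
have properQ (H : {group rT}) :
    N \subset H -> H \proper G -> H / N \proper G / N.
  move=> sNH /andP[sHG nsGH]; rewrite properE quotientS //=.
  by rewrite quotientSGK.
have index4 (H : {group rT}) :
    P \subset H -> H \proper G -> #|H : 'Phi(H)| <= 4.
  move=> sPH ltHG; have sHG := proper_sub ltHG.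
  rewrite -(index_Phi_mod_power4 pG sPH sHG).
  rewrite index_Phi_grank ?quotient_pgroup ?(pgroupS sHG) ?(leq_exp2l _ 2) //.
  by apply/metacyclic_grank/metaQ/properQ => //; apply: subset_trans sPH.
(* Otherwise [G / N], whose proper subgroups are metacyclic and so 2-generated, would be metacyclic
   by Blackburn's criterion. *)
have gt4 : 4 < #|G : P|.
  rewrite ltnNge; apply: contra nmQ => le4.
  apply: metacyclic_rank2_up_to_index2 => // Hb sHQ _.
  have [-> | ltHQ] := eqVproper sHQ; first by rewrite index_Phi_mod_power4.
  rewrite index_Phi_grank ?(pgroupS sHQ) ?(leq_exp2l _ 2) //.
  exact/metacyclic_grank/metaQ.
move=> H ltHG; have [eHG | [M maxM sHM]] := maximal_exists (proper_sub ltHG).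
  by rewrite eHG properxx in ltHG.
apply: metacyclicS sHM _.
have sMG := proper_sub (maxgroupp maxM); have pM := pgroupS sMG pG.
have sPM : P \subset M := Phi_sub_max maxM.
have sPhiM : 'Phi(M) \subset P := PhiS pG sMG.
have iMP : 4 <= #|M : P|.
  have [k oMP] := p_natP (pnat_dvd (dvdn_indexg M P) pM).
  move: gt4; rewrite -(Lagrange_index sMG sPM) (p_maximal_index pG maxM) oMP.
  by rewrite -expnS -[4]/(2 ^ 2)%N ltn_exp2l // leq_exp2l.
(* ['Phi(M)] lies in [P], and [#|M : 'Phi(M)| <= 4 <= #|M : P|] leaves no room between them. *)
have ePM : P = 'Phi(M)%G.
  apply/val_inj/eqP; rewrite eqEsubset sPhiM andbT -indexg_eq1 eqn_leq.
  rewrite indexg_gt0 andbT -(leq_pmul2l (_ : 0 < #|M : P|)) //.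
  rewrite Lagrange_index // muln1.
  by apply: leq_trans iMP; apply: index4 (maxgroupp maxM).
apply: metacyclic_rank2_up_to_index2 => // X sXM iMX.
apply: index4; last exact: sub_proper_trans sXM (maxgroupp maxM).
rewrite ePM; move: iMX; rewrite leq_eqVlt ltnS => /orP[/eqP iMX | iMX].
  by apply/Phi_sub_max/p_index_maximal; rewrite ?iMX.
have -> : X = M; last exact: Phi_sub.
apply/val_inj/eqP; rewrite eqEsubset sXM -indexg_eq1 eqn_leq iMX.
exact: indexg_gt0.
Qed.

Theorem theorem1p9 (aT rT : finGroupType) (A : {group aT}) (G : {group rT})
    (to : groupAction A G) (pA : 2.-group A) (pG : 2.-group G) :
  (d_maximal (to / power_subgroup 4 G)%gact A (G / power_subgroup 4 G)%G ->
     d_maximal to A G)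
  /\ (minimal_nonmetacyclic (G / power_subgroup 4 G)%G ->
     minimal_nonmetacyclic G).
Proof.
split; first exact: d_maximal_of_quotient.
exact: minimal_nonmetacyclic_of_quotient.
Qed.
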